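(* Let $Q\subset\mathbb{R}^m$ be closed, let $G\colon\mathbb{R}^m\to\mathbb{R}^n$ be twice continuously differentiable, put $S:=G(Q)$ and $\Phi(x):=Q\cap G^{-1}(x)=\{y\in Q\mid G(y)=x\}$ for $x\in\mathbb{R}^n$, and let $\bar x\in S$ be such that $\Phi\colon\mathbb{R}^n\rightrightarrows\mathbb{R}^m$ is inner semicompact at $\bar x$ with respect to $S$. Then for each $x^*\in\mathbb{R}^n$ and $u\in\mathbb{R}^n$ and each pair $(y,v)\in Q\times\mathbb{R}^m$ with $G(y)=\bar x$ and $\nabla G(y)v=u$, $$( * )\qquad \mathrm{d}^2\delta_S(\bar x;x^* )(u)\ \le\ -\langle x^*,\nabla^2G(y)(v,v)\rangle+\mathrm{d}^2\delta_Q(y;\nabla G(y)^\top x^* )(v),$$ and the converse inequality always holds if, additionally, $u\notin T_S(\bar x)$ or $\langle x^*,u\rangle<0$, in which cases both sides of $( * )$ equal $\infty$. Given $u\in T_S(\bar x)$ with $\langle x^*,u\rangle=0$, assume that $\Phi$ is inner calm* at $\bar x$ in direction $u$ with respect to $S$. Then $$\mathrm{d}^2\delta_S(\bar x;x^* )(u)=\inf_{y\in Q,\ G(y)=\bar x,\ \nabla G(y)v=u}\Bigl(-\langle x^*,\nabla^2G(y)(v,v)\rangle+\mathrm{d}^2\delta_Q(y;\nabla G(y)^\top x^* )(v)\Bigr).$$ Furthermore, if $\mathrm{d}^2\delta_S(\bar x;x^* )(u)$ is finite, then there exists a pair $(y,v)\in Q\times\mathbb{R}^m$ with $G(y)=\bar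 x$ and $\nabla G(y)v=u$ such that $( * )$ holds as equality, i.e., the infimum is attained.
   Context: $\delta_S$ denotes the indicator function of $S$ ($0$ on $S$, $+\infty$ off $S$). For a function $h\colon\mathbb{R}^n\to\mathbb{R}\cup\{-\infty,\infty\}$ with $|h(\bar z)|<\infty$ and $z^*\in\mathbb{R}^n$, the second subderivative is $$\mathrm{d}^2h(\bar z;z^* )(w):=\liminf_{t\downarrow0,\,w'\to w}\frac{h(\bar z+tw')-h(\bar z)-t\langle z^*,w'\rangle}{\frac12t^2}\in[-\infty,\infty].$$ $\nabla G(y)$ is the Jacobian and $\langle x^*,\nabla^2G(y)(v,v)\rangle:=\sum_{i=1}^nx_i^*\,v^\top\nabla^2G_i(y)v$. The tangent cone is $T_S(\bar x):=\{u\mid\exists t_k\downarrow0,\,u_k\to u\colon\bar x+t_ku_k\in S\ \forall k\}$. $\Phi$ is inner semicompact at $\bar x$ w.r.t. $S$ if for each sequence $x_k\to\bar x$ with $x_k\in S$ for all $k$ there exist $y\in\mathbb{R}^m$, a subsequence $x_{k_\ell}$, and $y_\ell\to y$ with $y_\ell\in\Phi(x_{k_\ell})$ for each $\ell$. $\Phi$ is inner calm* at $\bar x$ in direction $u$ w.r.t. $S$ if there is $\kappa>0$ such that for each sequence $x_k=\bar x+t_ku_k\in S$ with $t_k\downarrow0$, $u_k\to u$, there exist $y\in\mathbb{R}^m$, a subsequence $x_{k_\ell}$, and $y_\ell\to y$ with $y_\ell\in\Phi(x_{k_\ell})$ and $\|y_\ell-y\|\le\kappa\|x_{k_\ell}-\bar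 x\|$ for each $\ell$. *)

(* Defs.v *)
From mathcomp Require Export all_boot all_order all_algebra.
From mathcomp Require Export all_classical all_reals all_analysis.
Export Order.TTheory GRing.Theory Num.Theory numFieldNormedType.Exports.

#[export] Set Implicit Arguments.
#[export] Unset Strict Implicit.
#[export] Unset Printing Implicit Defensive.

Local Open Scope classical_set_scope.
Local Open Scope ring_scope.

(* Vectors of R^n are row vectors 'rV[R]_n, the convention of MathComp's
   Jacobian: 'd G y v = v *m 'J G y when G is differentiable at y. *)

Definition dotp (R : realType) (n : nat) (x y : 'rV[R]_n) : R :=
  \sum_(i < n) x 0 i * y 0 i.

(* The library norm on 'rV[R]_n is the sup norm; this is the Euclidean one. *)
Definition enorm (R : realType) (n : nat) (x : 'rV[R]_n) : R :=
  Num.sqrt (dotp x x).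

(* On the finite-dimensional spaces where C1 is used below, continuity of
   y |-> 'd f y v for every v amounts to continuity of y |-> 'd f y. *)
Definition C1 (R : realType) (V W : normedModType R) (f : V -> W) : Prop :=
  (forall y, differentiable f y) /\ (forall v, continuous (fun y => 'd f y v)).

Definition C2 (R : realType) (m n : nat) (G : 'rV[R]_m -> 'rV[R]_n) : Prop :=
  C1 G /\ C1 (fun y => 'J G y).

(* 'J G y is the transpose of the n x m Jacobian, so nabla G y *m v^T is
   the column vector of the usual product of the Jacobian with v. *)
Definition nabla (R : realType) (m n : nat) (G : 'rV[R]_m -> 'rV[R]_n)
    (y : 'rV[R]_m) : 'M[R]_(n, m) := ('J G y)^T.

Definition nabla_app (R : realType) (m n : nat) (G : 'rV[R]_m -> 'rV[R]_n)
    (y v : 'rV[R]_m) : 'rV[R]_n := (nabla G y *m v^T)^T.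

Definition nablaT_app (R : realType) (m n : nat) (G : 'rV[R]_m -> 'rV[R]_n)
    (y : 'rV[R]_m) (xs : 'rV[R]_n) : 'rV[R]_m := ((nabla G y)^T *m xs^T)^T.

Definition hessian (R : realType) (m : nat) (f : 'rV[R]_m -> R)
    (y : 'rV[R]_m) : 'M[R]_m :=
  \matrix_(j < m, k < m)
    'D_(delta_mx 0 j) (fun z => 'D_(delta_mx 0 k) f z) y.

Definition nabla2_form (R : realType) (m n : nat) (G : 'rV[R]_m -> 'rV[R]_n)
    (xs : 'rV[R]_n) (y v : 'rV[R]_m) : R :=
  \sum_(i < n) xs 0 i * (v *m hessian (fun z => G z 0 i) y *m v^T) 0 0.

Definition delta (R : realType) (n : nat) (S : set 'rV[R]_n) (x : 'rV[R]_n) :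
  \bar R := if x \in S then 0%E else +oo%E.

(* Only meaningful when h z is finite. *)
Definition d2 (R : realType) (n : nat) (h : 'rV[R]_n -> \bar R)
    (z zs w : 'rV[R]_n) : \bar R :=
  limf_einf (fun p : R * 'rV[R]_n =>
      (h (z + p.1 *: p.2)%R - h z - (p.1 * dotp zs p.2)%:E)
        / (2^-1 * p.1 ^+ 2)%:E)%E
    (filter_prod (0 : R)^'+ (nbhs w)).

(* As usual in variational analysis, t_k tends to 0 from the right without
   having to be monotone. *)
Definition tends_down0 (R : realType) (t : nat -> R) : Prop :=
  (forall k, 0 < t k) /\ (t @ \oo --> (0 : R)).

Definition tangent_cone (R : realType) (n : nat) (S : set 'rV[R]_n)
    (x : 'rV[R]_n) : set 'rV[R]_n :=
  [set u | exists (t : nat -> R) (u_ : nat -> 'rV[R]_n),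
    [/\ tends_down0 t, u_ @ \oo --> u & forall k, S (x + t k *: u_ k)]].

Definition inner_semicompact (R : realType) (m n : nat)
    (Phi : 'rV[R]_n -> set 'rV[R]_m) (x : 'rV[R]_n) (S : set 'rV[R]_n) : Prop :=
  forall x_ : nat -> 'rV[R]_n, x_ @ \oo --> x -> (forall k, S (x_ k)) ->
  exists (y : 'rV[R]_m) (k : nat -> nat) (y_ : nat -> 'rV[R]_m),
    [/\ {homo k : i j / (i < j)%N}, y_ @ \oo --> y &
        forall l, Phi (x_ (k l)) (y_ l)].

Definition inner_calm_star (R : realType) (m n : nat)
    (Phi : 'rV[R]_n -> set 'rV[R]_m) (x u : 'rV[R]_n) (S : set 'rV[R]_n) : Prop :=
  exists2 kappa : R, 0 < kappa &
  forall (t : nat -> R) (u_ : nat -> 'rV[R]_n),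
  tends_down0 t -> u_ @ \oo --> u -> (forall k, S (x + t k *: u_ k)) ->
  exists (y : 'rV[R]_m) (k : nat -> nat) (y_ : nat -> 'rV[R]_m),
    [/\ {homo k : i j / (i < j)%N}, y_ @ \oo --> y,
        (forall l, Phi (x + t (k l) *: u_ (k l)) (y_ l)) &
        forall l, enorm (y_ l - y) <=
          kappa * enorm (x + t (k l) *: u_ (k l) - x)].

Definition fiber (R : realType) (m n : nat) (Q : set 'rV[R]_m)
    (G : 'rV[R]_m -> 'rV[R]_n) (x : 'rV[R]_n) : set 'rV[R]_m :=
  Q `&` G @^-1` [set x].

Definition admissible_pairs (R : realType) (m n : nat) (Q : set 'rV[R]_m)
    (G : 'rV[R]_m -> 'rV[R]_n) (x u : 'rV[R]_n) : set ('rV[R]_m * 'rV[R]_m) :=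
  [set yv | [/\ Q yv.1, G yv.1 = x & nabla_app G yv.1 yv.2 = u]].

Definition chain_rhs (R : realType) (m n : nat) (Q : set 'rV[R]_m)
    (G : 'rV[R]_m -> 'rV[R]_n) (xs : 'rV[R]_n) (y v : 'rV[R]_m) : \bar R :=
  ((- nabla2_form G xs y v)%:E + d2 (delta Q) y (nablaT_app G y xs) v)%E.

(* Main.v *)
Require Import Defs.
From mathcomp Require Import ring.

Local Open Scope classical_set_scope.
Local Open Scope ring_scope.

(** The difference quotients defining the two second subderivatives match
    exactly. A step [(t, w)] at [y] inside [Q] is carried by [G] to the step
    [(t, (G (y + t w) - G y) / t)] at [G y] inside [G @` Q], and the quotient of
    the image step is the quotient of the original step minus twice the second
    order Taylor remainder of [<xs, G>] divided by [t^2] ([sdquot_image]).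

    As [t] decreases to 0 and [w] tends to [v], the image direction tends to
    ['d G y v] ([cvg_dir_quotient]) and the remainder term to
    [nabla2_form G xs y v] ([cvg_taylor2]). Every approximation of [v] thus
    yields one of [u = 'd G y v], which gives the inequality for an arbitrary
    pair [(y, v)] ([d2_image_le]). When [u] is not tangent, or when
    [<xs, u> < 0], the left side is infinite by inspection of the quotients
    ([d2_lty_tangent], [d2_dotp_lt0]), and the inequality forces the right side
    to be infinite as well.

    Conversely, if the left side is not [+oo], some sequence of steps
    [(t_k, u_k)] realizes the lower limit. Inner calmness* lifts a subsequence
    to points [y_l] of [Q] that converge to some [y] with
    [|y_l - y| = O(t_l)], so the directions [v_l = (y_l - y) / t_l] are bounded
    and accumulate at some [v]. The same identity of quotients, read backwards,
    shows that this pair satisfies the converse inequality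
    ([chain_rhs_le_d2]). So the infimum is attained whenever the left side is
    not [+oo], and both sides are [+oo] otherwise. *)

(** * Lower limits along filters *)

Section limf_einf.
Context {T : choiceType} {X : filteredType T} {R : realType}.
Implicit Types (f g : X -> \bar R) (F : set_system X).
Local Open Scope ereal_scope.

Lemma limf_einf_ge F f c :
  (\forall x \near F, c <= f x) -> c <= limf_einf f F.
Proof.
move=> Fc; rewrite limf_einfE.
apply: (@le_trans _ _ (ereal_inf (f @` [set x | c <= f x]))).
  by apply: le_ereal_inf_tmp => _ [x cfx <-].
by apply: ereal_sup_ubound; exists [set x | c <= f x].
Qed.

Lemma limf_einf_gt F f c : Filter F ->
  c < limf_einf f F -> \forall x \near F, c < f x.
Proof.
move=> FF; rewrite limf_einfE => /ereal_sup_gt[_ [V FV <-]] cV.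
apply: filterS FV => x Vx; apply: lt_le_trans cV _.
by apply: ereal_inf_lbound; exists x.
Qed.

(** Comparing lower limits through the reals below them avoids separate
    treatment of the infinite values. *)
Lemma lee_real_lt (a b : \bar R) :
  (forall c : R, c%:E < a -> c%:E <= b) -> a <= b.
Proof.
case: a => [a| |] ab; [|rewrite leye_eq|by rewrite leNye].
  by apply/lee_subgt0Pr => e e0; apply: ab; rewrite lte_fin ltrBlDr ltrDl.
by apply/eqP/eqyP => r _; apply: ab; rewrite ltry.
Qed.

(** The additive comparison used in both directions of the chain rule: a
    convergent real perturbation shifts the lower limit by its limit, even when
    the lower limits are infinite. *)
Lemma limf_einf_le_add F f g (r : X -> R) (l : R) : Filter F ->
  r @ F --> l -> (\forall x \near F, f x <= g x + (r x)%:E) ->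
  limf_einf f F <= limf_einf g F + l%:E.
Proof.
move=> FF rl fgr; apply: lee_real_lt => c cf.
rewrite -leeBlDr//; apply/lee_subgt0Pr => e e0.
apply: limf_einf_ge; near=> x.
have fx : f x <= g x + (r x)%:E by near: x.
have cx : c%:E < f x by near: x; exact: limf_einf_gt.
have rx : (r x < l + e)%R.
  by near: x; apply: (cvgr_lt l) => //; rewrite ltrDl.
rewrite leeBlDr// leeBlDr// (le_trans (ltW cx))// (le_trans fx)//.
by rewrite -addeA leeD2l// -EFinD lee_fin addrC ltW.
Unshelve. all: by end_near. Qed.

Lemma limf_einf_le F f (L : \bar R) : ProperFilter F ->
  (forall c, L < c -> \forall x \near F, f x < c) -> limf_einf f F <= L.
Proof.
move=> FF fL; apply: lee_real_lt => c /limf_einf_gt cf.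
rewrite leNgt; apply/negP => /fL fc.
have [x [cx xc]] := filter_ex (filterI cf fc).
by have := lt_trans cx xc; rewrite ltxx.
Qed.

End limf_einf.

(** Restricting the approach to the limit can only raise the lower limit. *)
Lemma limf_einf_comp {T U : choiceType} {X : filteredType T}
    {Y : filteredType U} {R : realType} (F : set_system X) (H : set_system Y)
    (f : X -> \bar R) (p : Y -> X) : Filter F -> Filter H ->
  p @ H --> F -> (limf_einf f F <= limf_einf (f \o p) H)%E.
Proof.
move=> FF FH pF; apply: lee_real_lt => c /limf_einf_gt cf.
apply: limf_einf_ge; apply: (pF [set x | c%:E <= f x]%E).
by apply: filterS cf => x /ltW.
Qed.

(** * Steps: positive lengths tending to 0, directions tending to [w] *)

Local Notation dirs w := (filter_prod 0^'+ (nbhs w)).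

Lemma dirs_gt0 {R : realType} {V : normedModType R} (w : V) :
  \forall p \near @filter_prod R V 0^'+ (nbhs w), 0 < p.1.
Proof. by have := nbhs_right_gt (0 : R); exact: filter_prod1. Qed.

Lemma dirs_step0 {R : realType} {V : normedModType R} (v w : V) :
  v + p.1 *: p.2 @[p --> @filter_prod R V 0^'+ (nbhs w)] --> v.
Proof.
rewrite -[X in _ --> X]addr0 -(scale0r w).
apply: cvgD; [exact: cvg_cst|apply: cvgZ; last exact: cvg_snd].
by apply: (cvg_trans (@cvg_fst _ _ _ _ _)); exact: cvg_within.
Qed.

(** Steps have a basis of boxes [0 < t < e], [w \in B], which are downward
    closed in [t]: a property holding for all steps near the limit holds
    uniformly along the segments that these steps span. *)
Lemma near_box {R : realType} {V : normedModType R} (w : V)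
    (P : R -> V -> Prop) :
  (\forall p \near dirs w, P p.1 p.2) ->
  \forall p \near dirs w, 0 < p.1 /\ forall s, 0 < s < p.1 -> P s p.2.
Proof.
case=> -[A B] /= [[e /= e0 eA] Bw] AB.
exists ([set t | 0 < t < e], B) => /=.
  split=> //; near=> t; apply/andP; split.
    by near: t; exact: nbhs_right_gt.
  by near: t; exact: nbhs_right_lt.
move=> [t w'] /= [/andP[t0 te] Bw']; split=> // s /andP[s0 st].
apply: (AB (s, w')); split => //=; apply: eA => //=.
by rewrite sub0r normrN gtr0_norm// (lt_trans st).
Unshelve. all: by end_near. Qed.

Lemma cvg_right_of_pos {R : realType} (T : Type) (F : set_system T)
    (FF : Filter F) (t : T -> R) :
  (forall k, 0 < t k) -> t @ F --> 0 -> t @ F --> 0^'+.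
Proof.
move=> t0 tF A A0; have := tF _ A0.
by apply: (@filterS _ F) => k; apply; exact: t0.
Qed.

(** The filter of steps is countably generated, so a lower limit along it is
    realized by a sequence; it is recorded through its upper bounds, which
    covers the value [-oo] and passes to subsequences. *)
Lemma minimizing_seq {R : realType} {V : normedModType R}
    (f : R * V -> \bar R) (w : V) :
  let L := limf_einf f (filter_prod (0 : R)^'+ (nbhs w)) in
  (L < +oo)%E ->
  exists (t : nat -> R) (w_ : nat -> V),
    [/\ tends_down0 t, w_ @ \oo --> w, forall k, (f (t k, w_ k) < +oo)%E &
      forall c, (L < c)%E -> \forall k \near \oo, (f (t k, w_ k) < c)%E].
Proof.
move=> L Loo.
(* Levels above L that decrease to L, whether L is finite or -oo. *)
have [c [cL coo cc]] : exists c : nat -> \bar R,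
    [/\ forall k, (L < c k)%E, forall k, (c k < +oo)%E &
      forall a, (L < a)%E -> \forall k \near \oo, (c k < a)%E].
  case: L Loo => [l _| //|_].
    exists (fun k => (l + k.+1%:R^-1)%:E); split.
    + by move=> k; rewrite lte_fin ltrDl invr_gt0.
    + by move=> k; rewrite ltry.
    + case=> [a|_|//]; last by near=> k; rewrite ltry.
      rewrite lte_fin => la; near=> k.
      rewrite lte_fin -ltrBrDl.
      near: k; apply: (cvgr_lt 0); last by rewrite subr_gt0.
      exact: cvg_harmonic.
  exists (fun k => (- k%:R)%:E); split.
  + by move=> k; rewrite ltNyr.
  + by move=> k; rewrite ltry.
  + case=> [a _|_|//]; last by near=> k; rewrite ltry.
    near=> k; rewrite lte_fin ltrNl.
    by near: k; exact: nbhs_infty_gtr.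
have pk k : exists p : R * V, [/\ 0 < p.1 < k.+1%:R^-1,
    ball w k.+1%:R^-1 p.2 & (f p < c k)%E].
  apply: contrapT => /forallNP np.
  have : (c k <= L)%E.
    apply: limf_einf_ge.
    exists ([set t | 0 < t < k.+1%:R^-1], ball w k.+1%:R^-1).
      split=> /=; last by apply: nbhsx_ballx; rewrite invr_gt0.
      near=> t; apply/andP; split; first by near: t; exact: nbhs_right_gt.
      by near: t; apply: nbhs_right_lt; rewrite invr_gt0.
    move=> p [p1 p2]; rewrite leNgt; apply/negP => fp.
    by apply: (np p); split.
  by rewrite leNgt cL.
have [p pP] := choice pk.
exists (fun k => (p k).1), (fun k => (p k).2); split.
- split=> [k|]; first by have [/andP[]] := pP k.
  apply: (squeeze_cvgr _ (cvg_cst 0) cvg_harmonic).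
  by near=> k; have [/andP[/ltW -> /ltW ->]] := pP k.
- apply/cvg_ballP => e e0; near=> k.
  have [_ + _] := pP k; apply: le_ball; apply: ltW.
  near: k; apply: (cvgr_lt 0) => //.
  exact: cvg_harmonic.
- by move=> k; have [_ _ fc] := pP k; rewrite -surjective_pairing (lt_trans fc).
- move=> a La; have := cc _ La; apply: filterS => k ca.
  by have [_ _ fc] := pP k; rewrite -surjective_pairing (lt_trans fc).
Unshelve. all: by end_near. Qed.

(** * Coordinates and the inner product *)

Lemma cvg_coord {R : realType} {T : Type} {F : set_system T} {FF : Filter F}
    k n (f : T -> 'M[R]_(k, n)) (l : 'M[R]_(k, n)) i j :
  f @ F --> l -> f x i j @[x --> F] --> l i j.
Proof.
move=> fl; exact: (cvg_comp f (fun M : 'M[R]_(k, n) => M i j) fl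
  (@coord_continuous R k n i j l)).
Qed.

Lemma cvg_sum_ord {R : realType} {T : Type} {F : set_system T} {FF : Filter F}
    n (f : 'I_n -> T -> R) (l : 'I_n -> R) :
  (forall i, f i x @[x --> F] --> l i) ->
  \sum_i f i x @[x --> F] --> \sum_i l i.
Proof. by move=> fl; apply: cvg_big => //; exact: add_continuous. Qed.

Lemma cvg_dotp {R : realType} {T : Type} {F : set_system T} {FF : Filter F} n
    (f g : T -> 'rV[R]_n) (a b : 'rV[R]_n) : f @ F --> a -> g @ F --> b ->
  dotp (f x) (g x) @[x --> F] --> dotp a b.
Proof.
by move=> fa gb; apply: cvg_sum_ord => i; apply: cvgM; exact: cvg_coord.
Qed.

Section dotp.
Context {R : realType} {n : nat}.
Implicit Types x y z : 'rV[R]_n.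

Lemma dotpDr x y z : dotp x (y + z) = dotp x y + dotp x z.
Proof. by rewrite -big_split /=; apply: eq_bigr => i _; rewrite mxE mulrDr. Qed.

Lemma dotpZr x y (a : R) : dotp x (a *: y) = a * dotp x y.
Proof. by rewrite mulr_sumr; apply: eq_bigr => i _; rewrite mxE mulrCA. Qed.

Lemma dotpBr x y z : dotp x (y - z) = dotp x y - dotp x z.
Proof. by rewrite dotpDr -scaleN1r dotpZr mulN1r. Qed.

Lemma dotpC x y : dotp x y = dotp y x.
Proof. by apply: eq_bigr => i _; rewrite mulrC. Qed.

Lemma enorm_coord x i : `|x 0 i| <= enorm x.
Proof.
rewrite -sqrtr_sqr ler_wsqrtr// /dotp (bigD1 i)//= -expr2 lerDl.
by apply: sumr_ge0 => j _; rewrite -expr2 sqr_ge0.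
Qed.

Lemma enormZ (a : R) x : 0 <= a -> enorm (a *: x) = a * enorm x.
Proof.
move=> a0; rewrite /enorm dotpZr dotpC dotpZr mulrA sqrtrM ?mulr_ge0//.
by rewrite -expr2 sqrtr_sqr ger0_norm.
Qed.

End dotp.

(** * Compactness along ultrafilters *)

Lemma ultra_fmap (T T' : Type) (U : set_system T) (f : T -> T') :
  UltraFilter U -> UltraFilter (f @ U).
Proof.
move=> UU; constructor=> [|H HH UH]; first exact: fmap_proper_filter.
apply/seteqP; split=> [A HA|]; last exact: UH.
have [//|UA] := in_ultra_setVsetC (f @^-1` A) UU.
have HnA : H (~` A) by apply: UH.
by have [x []] := filter_ex (filterI HA HnA).
Qed.

(** Bolzano-Weierstrass without extracting a subsequence: along an ultrafilter
    a bounded sequence of vectors simply converges. *)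
Lemma ultra_cvg_bounded {R : realType} {T : Type} (U : set_system T) k
    (v : T -> 'rV[R]_k) (M : R) :
  UltraFilter U ->
  (\forall l \near U, forall i, `|v l 0 i| <= M) ->
  exists w : 'rV[R]_k, v @ U --> w.
Proof.
move=> UU vM.
have : compact [set x : 'rV[R]_k | forall i, `[- M, M]%classic (x 0 i)].
  apply: (@rV_compact _ _ (fun=> `[- M, M]%classic)) => i.
  exact: segment_compact.
rewrite compact_ultra => /(_ (v @ U) (ultra_fmap v UU)) [|w [_ vw]].
  2: by exists w.
by move: vM; apply: (@filterS _ U) => l vl i /=; rewrite in_itv /= -ler_norml.
Qed.

(** * First and second order expansions along steps *)

Lemma diff_remainder {R : realType} {V W : normedModType R} (f : V -> W)
    (y : V) : differentiable f y -> forall e, 0 < e ->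
  \forall h \near (0 : V), `|f (y + h) - f y - 'd f y h| <= e * `|h|.
Proof.
move=> df e e0; have dfE := diff_locallyxC df.
near=> h; rewrite dfE.
have -> (a b c : W) : a + b + c - a - b = c.
  by rewrite -addrA -opprD addrAC subrr add0r.
by near: h; exact: littleoP.
Unshelve. all: by end_near. Qed.

(** A differentiable function has its directional derivatives in the Hadamard
    sense: the direction may vary with the step. *)
Lemma cvg_dir_quotient {R : realType} {V W : normedModType R} (f : V -> W)
    (y v : V) : differentiable f y ->
  p.1^-1 *: (f (y + p.1 *: p.2) - f y) @[p --> dirs v] --> 'd f y v.
Proof.
move=> df.
have pv : p.2 @[p --> @filter_prod R V 0^'+ (nbhs v)] --> v by exact: cvg_snd.
have dv : 'd f y p.2 @[p --> @filter_prod R V 0^'+ (nbhs v)] --> 'd f y v.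
  by apply: continuous_cvg pv; exact: diff_continuous.
have s0 : p.1 *: p.2 @[p --> @filter_prod R V 0^'+ (nbhs v)] --> (0 : V).
  by have := @dirs_step0 R V 0 v; under eq_cvg do rewrite add0r.
apply/cvgrPdist_le => e e0.
(* Close to v, the directions have norm at most M. *)
pose M := `|v| + 1.
have M0 : 0 < M by rewrite ltr_wpDl.
near=> p.
have p0 : 0 < p.1 by near: p; exact: dirs_gt0.
rewrite -(subrKA ('d f y p.2)) (splitr e) (le_trans (ler_normD _ _))// lerD//.
  near: p; have /cvgrPdist_le := dv; apply; exact: divr_gt0.
have -> : 'd f y p.2 - p.1^-1 *: (f (y + p.1 *: p.2) - f y) =
    - (p.1^-1 *: (f (y + p.1 *: p.2) - f y - 'd f y (p.1 *: p.2))).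
  rewrite [in RHS]scalerBr [X in _ = - (_ - _ *: X)]linearZ /=.
  by rewrite scalerA mulVf ?gt_eqF// scale1r opprB.
rewrite normrN normrZ normfV gtr0_norm// ler_pdivrMl//.
have : `|f (y + p.1 *: p.2) - f y - 'd f y (p.1 *: p.2)| <=
    e / 2 / M * `|p.1 *: p.2|.
  near: p; apply: (s0 [set h | `|f (y + h) - f y - 'd f y h| <= _ * `|h|]).
  by apply: diff_remainder; rewrite // !divr_gt0.
move=> /le_trans; apply.
rewrite normrZ gtr0_norm// mulrCA ler_pM2l// mulrAC ler_pdivrMr//.
rewrite ler_pM2l ?divr_gt0//.
rewrite -(subrK v p.2) addrC (le_trans (ler_normD _ _))// lerD// ltW// distrC.
by near: p; have /cvgrPdist_lt := pv; apply.
Unshelve. all: by end_near. Qed.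

Lemma is_derive_dotp {R : realType} {n : nat} {V : normedModType R}
    (f : V -> 'rV[R]_n) (x : 'rV[R]_n) (y v : V) (s : R) :
  differentiable f (y + s *: v) ->
  is_derive s 1 (fun s : R => dotp x (f (y + s *: v)))
    (dotp x ('d f (y + s *: v) v)).
Proof.
move=> df; set l := dotp x _.
have H : h^-1 *:
    (((fun s : R => dotp x (f (y + s *: v))) \o shift s) (h *: 1) -
      dotp x (f (y + s *: v))) @[h --> (0 : R)^'] --> l.
  rewrite /l -deriveE//.
  have := cvg_dotp (cvg_cst x) (diff_derivable (v := v) df).
  move=> H1; apply: (cvg_trans _ (H1 _ _)); apply: near_eq_cvg; near=> h => /=.
  rewrite dotpZr dotpBr; congr (_ * (dotp _ (f _) - _)).
  by rewrite scalerDl scaler1 addrCA.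
apply: DeriveDef; first by apply/cvg_ex; exists l.
exact/cvg_lim.
Unshelve. all: by end_near. Qed.

Lemma derive_coord {R : realType} {V : normedModType R} {k l : nat}
    (f : V -> 'M[R]_(k, l)) (y v : V) i j : differentiable f y ->
  'D_v (fun z => f z i j) y = 'd f y v i j.
Proof.
move=> df; rewrite -deriveE//.
have dv : derivable f y v by exact: diff_derivable.
by rewrite (derive_mx dv) mxE.
Qed.

Lemma diff_jacobian {R : realType} {m n : nat} (G : 'rV[R]_m -> 'rV[R]_n) y v :
  'd G y v = v *m 'J G y.
Proof. by rewrite /jacobian mul_rV_lin1. Qed.

Lemma dotp_jacobianB {R : realType} {m n : nat} (G : 'rV[R]_m -> 'rV[R]_n)
    (xs : 'rV[R]_n) (y z w : 'rV[R]_m) :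
  dotp xs (w *m ('J G y - 'J G z)) = dotp xs ('d G y w) - dotp xs ('d G z w).
Proof.
rewrite mulmxBr dotpBr.
exact: (f_equal2 (fun a b => dotp xs a - dotp xs b)
  (esym (diff_jacobian G y w)) (esym (diff_jacobian G z w))).
Qed.

(** The form built from second partial derivatives is the derivative of the
    Jacobian in direction [v], applied to [v]. *)
Lemma nabla2_formE {R : realType} {m n : nat} (G : 'rV[R]_m -> 'rV[R]_n)
    (xs : 'rV[R]_n) (y v : 'rV[R]_m) :
  (forall z, differentiable G z) -> differentiable (fun z => 'J G z) y ->
  nabla2_form G xs y v = dotp xs (v *m 'd (fun z => 'J G z) y v).
Proof.
move=> dG dJ.
have JE k i : (fun z => 'D_(delta_mx 0 k) (fun z => G z 0 i) z) =
    (fun z => 'J G z k i).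
  by apply/funext => z; rewrite derive_coord// /jacobian mxE.
have HE i j k : hessian (fun z => G z 0 i) y j k =
    'd (fun z => 'J G z) y (delta_mx 0 j) k i.
  by rewrite mxE JE derive_coord.
apply: eq_bigr => i _; congr (_ * _); rewrite !mxE; apply: eq_bigr => k _.
rewrite !mxE mulrC; congr (_ * _).
rewrite [in RHS](row_sum_delta v) linear_sum summxE; apply: eq_bigr => j _.
by rewrite HE linearZ mxE.
Qed.

(** Second order Taylor expansion along steps. By Cauchy's mean value theorem,
    comparing with [s ^ 2] on [0, t], the remainder for the step [(t, w)] is the
    first order quotient [q] of the Jacobian at an intermediate step [(c, w)].
    By [near_box] the convergence of [q] is uniform over [0 < c < t], so
    differentiability of the Jacobian at the single point [y] controls it. *)
Lemma cvg_taylor2 {R : realType} {m n : nat} (G : 'rV[R]_m -> 'rV[R]_n)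
    (xs : 'rV[R]_n) (y v : 'rV[R]_m) :
  (forall z, differentiable G z) -> differentiable (fun z => 'J G z) y ->
  2 * (dotp xs (G (y + p.1 *: p.2) - G y) - p.1 * dotp xs ('d G y p.2))
    / p.1 ^+ 2 @[p --> dirs v] --> nabla2_form G xs y v.
Proof.
move=> dG dJ; rewrite nabla2_formE//; set l := dotp _ _.
pose E (p : R * 'rV[R]_m) := p.1^-1 *: ('J G (y + p.1 *: p.2) - 'J G y).
have cE : E p @[p --> dirs v] --> 'd (fun z => 'J G z) y v.
  exact: cvg_dir_quotient.
pose q p := dotp xs (p.2 *m E p).
have cq : q p @[p --> dirs v] --> l.
  rewrite /q /l; apply: cvg_sum_ord => i; apply: cvgM; first exact: cvg_cst.
  under eq_cvg do rewrite mxE.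
  rewrite mxE; apply: cvg_sum_ord => k.
  apply: cvgM; apply: cvg_coord => //; exact: cvg_snd.
apply/cvgrPdist_le => e e0.
have : \forall p \near @filter_prod R 'rV[R]_m 0^'+ (nbhs v),
    `|l - q (p.1, p.2)| <= e.
  by near do rewrite -surjective_pairing; move/cvgrPdist_le : cq; exact.
move=> /(near_box (P := fun s w => `|l - q (s, w)| <= e)).
apply: filterS => -[t w] /= [t0 qe].
(* The Taylor remainder is f t - f 0. *)
pose f s := dotp xs (G (y + s *: w)) - s * dotp xs ('d G y w).
pose df s := dotp xs ('d G (y + s *: w) w) - dotp xs ('d G y w).
have fdf s : is_derive s (1 : R) f (df s).
  apply: is_deriveB; first exact: is_derive_dotp.
  by apply: is_derive_eq; rewrite scaler0 add0r; exact: mulr1.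
have gdg s : is_derive s (1 : R) (fun s => s ^+ 2) (2 * s).
  by apply: is_derive_eq; rewrite scaler1 mulr_natl mulr2n.
have cf : {within `[0, t], continuous f}.
  by apply: derivable_within_continuous => s _; exact: ex_derive.
have cg : {within `[0, t], continuous (fun s : R => s ^+ 2)}.
  by apply: derivable_within_continuous => s _; exact: ex_derive.
have [|c c0t] := cauchy_MVT t0 cf cg (fun s _ => fdf s) (fun s _ => gdg s) _.
  by move=> s; rewrite in_itv /= => /andP[s0 _]; rewrite mulf_neq0// gt_eqF.
move: c0t; rewrite in_itv /= => c0t fc.
have [c0 _] := andP c0t.
suff -> : 2 * (dotp xs (G (y + t *: w) - G y) - t * dotp xs ('d G y w)) /
    t ^+ 2 = q (c, w) by exact: qe.
have -> : q (c, w) = df c / c.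
  rewrite /df -dotp_jacobianB /q /E -scalemxAr dotpZr.
  exact: mulrC.
have -> : df c / c = 2 * (df c / (2 * c)).
  by field; rewrite gt_eqF.
rewrite fc /f !scale0r !addr0 !mul0r expr0n /= !subr0 dotpBr mulrA.
by rewrite addrAC.
Unshelve. all: by end_near. Qed.

(** * Second order difference quotients of indicators *)

Lemma nabla_appE {R : realType} {m n : nat} (G : 'rV[R]_m -> 'rV[R]_n) y v :
  nabla_app G y v = 'd G y v.
Proof. by rewrite /nabla_app trmx_mul /nabla !trmxK diff_jacobian. Qed.

Lemma dotp_nablaT {R : realType} {m n : nat} (G : 'rV[R]_m -> 'rV[R]_n) y xs v :
  dotp (nablaT_app G y xs) v = dotp xs ('d G y v).
Proof.
have dotE k (a b : 'rV[R]_k) : dotp a b = (a *m b^T) 0 0.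
  by rewrite mxE; apply: eq_bigr => i _; rewrite mxE.
rewrite [LHS]dotE diff_jacobian [RHS]dotE /nablaT_app /nabla.
by rewrite !trmx_mul !trmxK mulmxA.
Qed.

(** The expression whose lower limit is [d2 (delta S) z zs], so that the two
    are convertible. *)
Definition sdquot {R : realType} {n : nat} (S : set 'rV[R]_n) (z zs : 'rV[R]_n)
    (p : R * 'rV[R]_n) : \bar R :=
  ((delta S (z + p.1 *: p.2)%R - delta S z - (p.1 * dotp zs p.2)%:E)
     / (2^-1 * p.1 ^+ 2)%:E)%E.

Section sdquot.
Context {R : realType} {n : nat}.
Variables (S : set 'rV[R]_n) (z zs : 'rV[R]_n).
Hypothesis Sz : S z.

Lemma sdquot_in t w : 0 < t -> S (z + t *: w) ->
  sdquot S z zs (t, w) = (- (2 * dotp zs w / t))%:E.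
Proof.
move=> t0 Sw; rewrite /sdquot /delta !mem_set//= sube0 add0e.
rewrite inver gt_eqF ?mulr_gt0 ?exprn_gt0// -EFinM; congr (_%:E).
by field; rewrite gt_eqF.
Qed.

Lemma sdquot_out t w : 0 < t -> ~ S (z + t *: w) ->
  sdquot S z zs (t, w) = +oo%E.
Proof.
move=> t0 Sw; rewrite /sdquot /delta memNset// mem_set//= sube0 addye//.
have t2 : 0 < 2^-1 * t ^+ 2 by rewrite mulr_gt0 ?exprn_gt0.
by rewrite gt0_mulye// inver gt_eqF// lte_fin invr_gt0.
Qed.

Lemma sdquot_ge t w : 0 < t ->
  ((- (2 * dotp zs w / t))%:E <= sdquot S z zs (t, w))%E.
Proof.
move=> t0; have [Sw|Sw] := pselect (S (z + t *: w)).
  by rewrite sdquot_in.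
by rewrite sdquot_out// leey.
Qed.

(** Steps with a finite quotient stay in [S], so a minimizing sequence of steps
    witnesses tangency. *)
Lemma d2_lty_tangent u : (d2 (delta S) z zs u < +oo)%E -> tangent_cone S z u.
Proof.
move=> /minimizing_seq[t [w_ [t0 wu fin _]]].
exists t, w_; split => // k; apply: contrapT => Sk.
by have := fin k; rewrite -/(sdquot _ _ _ _) sdquot_out// t0.1.
Qed.

(** The quotient is at least [- 2 <zs, w> / t], which blows up. *)
Lemma d2_dotp_lt0 u : dotp zs u < 0 -> d2 (delta S) z zs u = +oo%E.
Proof.
move=> zsu; apply/eqyP => c _; apply: limf_einf_ge.
(* The bound c < - 2 <zs, w> / t with t cleared, which has a limit. *)
have H : c * p.1 + 2 * dotp zs p.2 @[p --> dirs u] --> c * 0 + 2 * dotp zs u.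
  apply: cvgD; apply: cvgM; try exact: cvg_cst.
    by apply: (cvg_trans (@cvg_fst _ _ _ _ _)); exact: cvg_within.
  apply: cvg_dotp; [exact: cvg_cst|exact: cvg_snd].
near=> p; have p0 : 0 < p.1 by near: p; exact: dirs_gt0.
have cp : c * p.1 + 2 * dotp zs p.2 < 0.
  near: p; apply: (cvgr_lt _ H).
  by rewrite mulr0 add0r pmulr_rlt0.
rewrite -/(sdquot _ _ _ _) [p]surjective_pairing.
apply: le_trans (sdquot_ge _ p0); rewrite lee_fin -mulNr ler_pdivlMr//=.
by rewrite -subr_le0 opprK ltW.
Unshelve. all: by end_near. Qed.

End sdquot.

(** * The chain rule *)

Section chain_rule.
Context {R : realType} {m n : nat}.
Variables (Q : set 'rV[R]_m) (G : 'rV[R]_m -> 'rV[R]_n) (xs : 'rV[R]_n).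
Hypothesis dG : forall z, differentiable G z.

(** Twice the second order Taylor remainder of [<xs, G>], divided by [t ^ 2]. *)
Let rem y (p : R * 'rV[R]_m) : R :=
  2 * (dotp xs (G (y + p.1 *: p.2) - G y) - p.1 * dotp xs ('d G y p.2))
    / p.1 ^+ 2.

(** Where the two sides of the chain rule meet: an exact identity between the
    quotients of a step in [Q] and of its image. *)
Lemma sdquot_image y t w : Q y -> 0 < t -> Q (y + t *: w) ->
  sdquot (G @` Q) (G y) xs (t, t^-1 *: (G (y + t *: w) - G y)) =
  (sdquot Q y (nablaT_app G y xs) (t, w) - (rem y (t, w))%:E)%E.
Proof.
move=> Qy t0 Qw; have SG z : Q z -> (G @` Q) (G z) by move=> Qz; exists z.
have tN0 : t != 0 by rewrite gt_eqF.
rewrite (sdquot_in _ (SG _ Qy))//; last first.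
  by rewrite scalerA divff// scale1r subrKC; exact: SG.
rewrite (sdquot_in _ Qy)// -EFinB dotp_nablaT dotpZr /rem /=; congr (_%:E).
by field.
Qed.

(** Steps towards [v] at [y] are turned by [phi] into steps towards ['d G y v]
    at [G y]; those leaving [Q] have quotient [+oo] and impose nothing. *)
Lemma d2_image_le y v : Q y -> differentiable (fun z => 'J G z) y ->
  (d2 (delta (G @` Q)) (G y) xs ('d G y v) <= chain_rhs Q G xs y v)%E.
Proof.
move=> Qy dJ.
pose phi (p : R * 'rV[R]_m) := (p.1, p.1^-1 *: (G (y + p.1 *: p.2) - G y)).
have cphi : phi @ dirs v --> dirs ('d G y v).
  exact: (cvg_pair (@cvg_fst _ _ 0^'+ (nbhs v) _) (cvg_dir_quotient (dG y))).
rewrite /chain_rhs addeC.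
apply: (le_trans (limf_einf_comp (sdquot (G @` Q) (G y) xs) _ _ cphi)).
apply: (@limf_einf_le_add _ _ _ _ _ _ (fun p => - rem y p)).
  by apply: cvgN; exact: cvg_taylor2.
near=> p; have p0 : 0 < p.1 by near: p; exact: dirs_gt0.
rewrite /comp /= -/(sdquot _ _ _ (phi p)) -/(sdquot _ _ _ p).
have [Qp|Qp] := pselect (Q (y + p.1 *: p.2)).
  by rewrite /phi sdquot_image// -surjective_pairing EFinN.
by rewrite [X in sdquot Q _ _ X]surjective_pairing (sdquot_out _ Qy)// leey.
Unshelve. all: by end_near. Qed.

(** Inner calmness* lifts a minimizing sequence of steps at [xbar] to steps at a
    point [y] of the fiber, with directions bounded in terms of [kappa] and
    [u]; a limit of these directions solves the converse inequality. *)
Lemma chain_rhs_le_d2 xbar u :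
  closed Q -> (forall z, differentiable (fun z => 'J G z) z) ->
  inner_calm_star (fiber Q G) xbar u (G @` Q) -> (G @` Q) xbar ->
  (d2 (delta (G @` Q)) xbar xs u < +oo)%E ->
  exists y v, [/\ Q y, G y = xbar, 'd G y v = u &
    (chain_rhs Q G xs y v <= d2 (delta (G @` Q)) xbar xs u)%E].
Proof.
move=> cQ dJ [kappa kappa0 calm] Sx; set L := d2 _ _ _ _ => Loo.
have [t [w [[t0 tc] wu fin lim]]] := minimizing_seq Loo.
have Sw j : (G @` Q) (xbar + t j *: w j).
  apply: contrapT => nS; have := fin j.
  by rewrite -/(sdquot _ _ _ _) sdquot_out.
have [y [k [y_ [hk yy Py yk]]]] := calm t w (conj t0 tc) wu Sw.
(* A strictly increasing extraction dominates the identity. *)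
have kinf : k @ \oo --> \oo.
  have lek l : (l <= k l)%N by elim: l => // l /leq_ltn_trans; apply; exact: hk.
  move=> A [N _ NA]; exists N => // l /= Nl; apply: NA => /=.
  exact: leq_trans Nl (lek l).
(* Passing to an ultrafilter on the indices makes the bounded directions v
   converge, in place of a second subsequence. *)
have [U [UU oU]] := ultraFilterLemma eventually_filter.
have kU : k @ U --> \oo by apply: cvg_trans kinf => A /oU.
pose a l := t (k l); pose b l := w (k l).
pose v l := (a l)^-1 *: (y_ l - y).
have a0 l : 0 < a l by exact: t0.
have aU : a @ U --> 0^'+.
  by apply: cvg_right_of_pos => //; exact: cvg_comp kU tc.
have aU0 : a @ U --> 0 by exact: cvg_comp kU tc.
have bU : b @ U --> u by exact: cvg_comp kU wu.
have yU : y_ @ U --> y by apply: cvg_trans yy => A /oU.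
have yE l : y_ l = y + a l *: v l.
  by rewrite /v scalerA divff ?gt_eqF// scale1r subrKC.
have GyE l : G (y_ l) = xbar + a l *: b l by case: (Py l).
have Qy_ l : Q (y_ l) by case: (Py l).
have Qy : Q y by apply: (closed_cvg Q cQ (nearW _ _) y yy).
have Gy : G y = xbar.
  have G1 : G (y_ l) @[l --> U] --> G y.
    have cG : {for y, continuous G} by exact: differentiable_continuous.
    exact: (cvg_comp y_ G yU cG).
  have G2 : G (y_ l) @[l --> U] --> xbar.
    have -> : (fun l => G (y_ l)) = (fun l => xbar + a l *: b l).
      exact/funext.
    have : xbar + a l *: b l @[l --> U] --> xbar + 0 *: u.
      by apply: cvgD; [exact: cvg_cst|exact: cvgZ].
    by rewrite scale0r addr0.
  exact: cvg_unique G1 G2.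
have [v0 vU] : exists v0 : 'rV[R]_m, v @ U --> v0.
  pose M := kappa * (enorm u + 1).
  apply: (@ultra_cvg_bounded _ _ _ _ _ M) => //.
  have bn : enorm (b l) @[l --> U] --> enorm u.
    have bb : dotp (b l) (b l) @[l --> U] --> dotp u u by apply: cvg_dotp.
    exact: (cvg_comp _ Num.sqrt bb (@sqrt_continuous R _)).
  near=> l => i.
  have bM : enorm (b l) <= enorm u + 1.
    by near: l; apply: (cvgr_le _ bn); rewrite ltrDl.
  apply: le_trans (enorm_coord _ _) _.
  rewrite /v enormZ ?invr_ge0 ?(ltW (a0 l))// ler_pdivrMl//.
  rewrite (le_trans (yk l))// -/(a l) -/(b l) addrC addKr.
  rewrite enormZ ?(ltW (a0 l))//.
  by rewrite mulrCA ler_pM2l// ler_pM2l.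
exists y, v0.
pose p l := (a l, v l).
have pU : p @ U --> dirs v0 by exact: (cvg_pair aU vU).
(* The image of the lifted step is the step it was lifted from. *)
have bE l : b l = (a l)^-1 *: (G (y + a l *: v l) - G y).
  by rewrite -yE GyE Gy addrC addKr scalerA mulVf ?gt_eqF// scale1r.
split => //.
  have H : (a l)^-1 *: (G (y + a l *: v l) - G y) @[l --> U] --> 'd G y v0.
    exact: (cvg_comp p (fun p => p.1^-1 *: (G (y + p.1 *: p.2) - G y)) pU
      (cvg_dir_quotient (dG y))).
  move: H; rewrite -(_ : b = fun l => _); last exact/funext.
  by move=> H; apply: cvg_unique H bU.
rewrite /chain_rhs -leeBrDl// -EFinN opprK.
apply: (le_trans (limf_einf_comp (sdquot Q y (nablaT_app G y xs)) _ _ pU)).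
apply: (@le_trans _ _ (limf_einf (fun l => sdquot (G @` Q) xbar xs (a l, b l)) U
   + (nabla2_form G xs y v0)%:E)%E).
  apply: limf_einf_le_add.
    exact: (cvg_comp p (rem y) pU (cvg_taylor2 (xs := xs) (v := v0) dG (dJ y))).
  near=> l.
  rewrite /= bE -Gy (sdquot_image Qy (a0 l)) ?subeK//.
  by rewrite -yE; exact: Qy_.
rewrite leeD2r//; apply: limf_einf_le => c /lim Lc.
exact: (kU _ Lc).
Unshelve. all: by end_near. Qed.

End chain_rule.

Theorem proposition4p10 (R : realType) (m n : nat) (Q : set 'rV[R]_m)
    (G : 'rV[R]_m -> 'rV[R]_n) (xbar : 'rV[R]_n) :
  closed Q -> C2 G -> (G @` Q) xbar ->
  inner_semicompact (fiber Q G) xbar (G @` Q) ->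
  (forall (xs u : 'rV[R]_n) (y v : 'rV[R]_m),
     Q y -> G y = xbar -> nabla_app G y v = u ->
     (d2 (delta (G @` Q)) xbar xs u <= chain_rhs Q G xs y v)%E /\
     (~ tangent_cone (G @` Q) xbar u \/ dotp xs u < 0 ->
      [/\ (chain_rhs Q G xs y v <= d2 (delta (G @` Q)) xbar xs u)%E,
          d2 (delta (G @` Q)) xbar xs u = +oo%E &
          chain_rhs Q G xs y v = +oo%E])) /\
  (forall xs u : 'rV[R]_n,
     tangent_cone (G @` Q) xbar u -> dotp xs u = 0 ->
     inner_calm_star (fiber Q G) xbar u (G @` Q) ->
     d2 (delta (G @` Q)) xbar xs u =
       ereal_inf [set chain_rhs Q G xs yv.1 yv.2 | yv in admissible_pairs Q G xbar u] /\
     (d2 (delta (G @` Q)) xbar xs u \is a fin_num ->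
      exists y v : 'rV[R]_m,
        [/\ Q y, G y = xbar, nabla_app G y v = u &
            d2 (delta (G @` Q)) xbar xs u = chain_rhs Q G xs y v])).
Proof.
move=> cQ [[dG _] [dJ _]] Sx _.
have chain_le (xs u : 'rV[R]_n) (y v : 'rV[R]_m) :
     Q y -> G y = xbar -> nabla_app G y v = u ->
     (d2 (delta (G @` Q)) xbar xs u <= chain_rhs Q G xs y v)%E.
  by move=> Qy <- <-; rewrite nabla_appE; exact: d2_image_le.
split=> xs u.
  move=> y v Qy Gy nu; have le := chain_le xs u y v Qy Gy nu.
  split=> // H.
  have d2oo : d2 (delta (G @` Q)) xbar xs u = +oo%E.
    case: H => [nT|]; last exact: d2_dotp_lt0.
    apply/eqP; rewrite -leye_eq leNgt; apply/negP => /(d2_lty_tangent Sx).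
    exact: nT.
  by move: le; rewrite d2oo leye_eq => /eqP ->.
move=> _ _ calm.
have att xs' := chain_rhs_le_d2 (xs := xs') dG cQ dJ calm Sx.
have eqd y v : Q y -> G y = xbar -> 'd G y v = u ->
    (chain_rhs Q G xs y v <= d2 (delta (G @` Q)) xbar xs u)%E ->
    d2 (delta (G @` Q)) xbar xs u = chain_rhs Q G xs y v.
  move=> Qy Gy du le; apply/le_anti; rewrite le andbT.
  by apply: chain_le => //; rewrite nabla_appE.
split.
  apply/le_anti/andP; split.
    by apply: le_ereal_inf_tmp => _ [[y v] [/= Qy Gy nu] <-]; exact: chain_le.
  have [Loo|] := ltP (d2 (delta (G @` Q)) xbar xs u) +oo%E; last first.
    by rewrite leye_eq => /eqP ->; rewrite leey.
  have [y [v [Qy Gy du le]]] := att _ Loo.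
  apply: le_trans le; apply: ereal_inf_lbound; exists (y, v) => //.
  by split => //=; rewrite nabla_appE.
move=> fin; have [|y [v [Qy Gy du le]]] := att xs; first by rewrite ltey_eq fin.
by exists y, v; split => //; [rewrite nabla_appE|exact: eqd].
Qed.
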